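(* For any positive integer $N$, there exists a positive integer $L_N$ such that for any real number $x \geq L_N$, there are at least $N$ primes in the closed interval $[15x, 16x]$. *)

(* Defs.v *)
From mathcomp Require Import all_boot all_order all_algebra.
From mathcomp Require Import boolp classical_sets functions cardinality reals.

(* Main.v *)
Require Import Defs.
From HB Require Import structures.
From Stdlib Require Import ZArith.
From mathcomp Require Import all_boot all_order all_algebra.
From mathcomp Require Import boolp classical_sets functions cardinality reals.
From mathcomp Require Import exp.
From mathcomp Require Import ssrZ zify ring lra.

(** The proof is a Chebyshev argument, sharpened by a computed certificate.

    For a function [F] on the naturals let S(F, n) be the sum of
    Lambda(d) F(n / d) over d >= 1, with Lambda the von Mangoldt function and
    / the integer quotient ([mangoldt_sum]).  Legendre's formula for the
    primes in a factorial says that S(id, n) = ln n! ([ln_fact]).  Hence, when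
    F(u) = sum_k b_k k (u / k) for finitely many b_k with sum zero, Stirling's
    formula gives S(F, n) = B n + O(ln n) with B = - sum_k b_k ln k
    ([mangoldt_sum_balanced]): such sums over primes are known exactly, up to
    a negligible error.

    Chebyshev's choice (30, -15, -10, -6, 1) on k = 1, 2, 3, 5, 30 has F >= 0
    everywhere and F = 30 on 1..5, which yields psi(n) <= c n + O(ln^2 n)
    with c about 1.1056 ([psi_le_linear]).  This inequality, used with no other
    input, only reaches intervals [x, r x] with r > 6/5, which is too wide.

    The primes with n / p = 15, that is n/16 < p <= n/15, are isolated by a
    second combination F, with periods up to 130, through the difference
    G(v) = F(v / 15) - F(v / 16).  Its k b_k / 1000 starts as the Moebius
    function, up to rounding, so that F is 1000 at 1 and 2 and then decreases
    very slowly for a while.  Hence G is 1000 at v = 15 and nonpositive at all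
    other v < 480, and beyond that it stays below a sparse step function:
       G(v) <= 1000 [v = 15] + sum_i w_i [240 s_i <= v]
    ([sieve_difference_le]).  Summed against Lambda, the left side becomes
    B n / 240 + O(ln n); the bracket [v = 15] counts the wanted primes with
    weight ln p, and O(sqrt n) prime powers; each step contributes
    w_i psi(n / (240 s_i)), which the bound on psi controls.  Since
    c (sum_i w_i / s_i) < B, about 837 against 988 ([sieve_rate_large]), the
    number of wanted primes is at least a positive multiple of n / ln n
    ([sieve_lower_bound]).  For n the integer part of 240 x, the condition
    n / p = 15 forces 15 x <= p <= 16 x.

    The coefficients b and the steps (s_i, w_i) were found by linear
    programming and rounded; only the inequalities they satisfy matter.  The
    majorant is verified on v < 240 * 480 by tabulating F, and a trivial bound
    on F accounts for all larger v ([certified_difference_le]).  The two rates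
    B and c are compared in units of (ln 2) / 16, through the position of
    k ^ 16 between powers of 2, so all computation is on integers. *)

Import Order.TTheory GRing.Theory Num.Theory.
Local Open Scope classical_set_scope.
Local Open Scope card_scope.
Local Open Scope ring_scope.

(** * Sums over prime powers *)

Section VonMangoldtSums.
Variable R : realType.
Implicit Types (F G : nat -> R) (N n q : nat).

(** The sum over d of Lambda(d) F(n / d), with the prime powers d = p ^ k
    listed by p and k.  The cutoff [N] is any number at least [n] (when F
    vanishes at 0, the terms with p or k beyond [n] are zero); keeping it apart
    from [n] lets one range of summation serve n, n / 15 and n / 16 at once. *)
Definition mangoldt_sum N F n : R :=
  \sum_(p < N.+1 | prime p) ln p%:R * \sum_(1 <= k < N.+1) F (n %/ p ^ k)%N.

Lemma ln_nat_ge0 n : 0 <= ln (n%:R : R).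
Proof. by case: n => [|n]; [rewrite ln0|rewrite ln_ge0 // ler1n]. Qed.

Lemma mangoldt_sum_le N F G n :
  (forall v, (v <= n)%N -> F v <= G v) -> mangoldt_sum N F n <= mangoldt_sum N G n.
Proof.
move=> FG; apply: ler_sum => p _; apply: ler_wpM2l; first exact: ln_nat_ge0.
by apply: ler_sum => k _; apply: FG; exact: leq_div.
Qed.

Lemma mangoldt_sumD N F G n :
  mangoldt_sum N (fun v => F v + G v) n = mangoldt_sum N F n + mangoldt_sum N G n.
Proof.
rewrite /mangoldt_sum -big_split; apply: eq_bigr => p _ /=.
by rewrite big_split mulrDr.
Qed.

Lemma mangoldt_sumZ N (a : R) F n :
  mangoldt_sum N (fun v => a * F v) n = a * mangoldt_sum N F n.
Proof.
rewrite /mangoldt_sum mulr_sumr; apply: eq_bigr => p _ /=.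
by rewrite -mulr_sumr mulrCA.
Qed.

Lemma mangoldt_sum_sum N (I : Type) (s : seq I) (F : I -> nat -> R) n :
  mangoldt_sum N (fun v => \sum_(i <- s) F i v) n =
  \sum_(i <- s) mangoldt_sum N (F i) n.
Proof.
elim: s => [|i s IH].
  rewrite big_nil /mangoldt_sum big1 // => p _; rewrite big1 ?mulr0 // => k _.
  by rewrite big_nil.
rewrite big_cons -IH -mangoldt_sumD /mangoldt_sum; apply: eq_bigr => p _.
by congr (_ * _); apply: eq_bigr => k _; rewrite big_cons.
Qed.

(** Integer quotients commute, so dilating F amounts to shrinking n.  This is
    what makes the same sum available at n / 15, n / 16 and n / (240 s). *)
Lemma mangoldt_sum_div N F n q :
  mangoldt_sum N (fun v => F (v %/ q)%N) n = mangoldt_sum N F (n %/ q)%N.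
Proof.
apply: eq_bigr => p _; congr (_ * _); apply: eq_bigr => k _.
by rewrite divnAC.
Qed.

Lemma ln_prime_factors N m : (0 < m <= N)%N ->
  ln (m%:R : R) = \sum_(p < N.+1 | prime p) ln p%:R * (logn p m)%:R.
Proof.
case/andP=> m0 mN.
have {1}-> : m = (\prod_(p < N.+1 | prime p) p ^ logn p m)%N.
  rewrite -{1}[m]partnT // (widen_partn _ mN) big_mkord /= big_mkcond.
  rewrite [RHS]big_mkcond /=; apply: eq_bigr => p _.
  by case: ifP => // pp; rewrite lognE pp.
pose K (x : nat) (y : R) := (0 < x)%N /\ ln x%:R = y.
suff [] : K (\prod_(p < N.+1 | prime p) p ^ logn p m)%N
            (\sum_(p < N.+1 | prime p) ln p%:R * (logn p m)%:R) by [].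
apply: big_rec2 => [|p x y pp [y0 IH]]; first by split=> //; rewrite ln1.
have p0 : (0 < p ^ logn p m)%N by rewrite expn_gt0 prime_gt0.
split; first by rewrite muln_gt0 p0.
rewrite natrM lnM ?posrE ?ltr0n // natrX lnXn ?ltr0n ?prime_gt0 // IH.
by rewrite mulr_natr.
Qed.

Lemma sum_div_pow_widen N n p : (1 < p)%N -> (n <= N)%N ->
  (\sum_(1 <= k < N.+1) n %/ p ^ k = \sum_(1 <= k < n.+1) n %/ p ^ k)%N.
Proof.
move=> p1 nN; rewrite (@big_cat_nat _ _ _ n.+1) //= [X in (_ + X)%N]big1_seq ?addn0 //.
move=> k; rewrite mem_index_iota => /andP[_ /andP[nk _]].
by rewrite divn_small // (ltn_trans nk) // ltn_expl.
Qed.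

(** Legendre's formula: floor (n / p ^ k) summed over k is the exponent of p in
    the factorial. *)
Lemma ln_fact N n : (n <= N)%N ->
  ln (n`!%:R : R) = mangoldt_sum N (fun v => v%:R) n.
Proof.
move=> nN; transitivity (\sum_(p < N.+1 | prime p) ln p%:R * (logn p n`!)%:R : R).
  elim: n nN => [|n IH] nN.
    by rewrite ln1 big1 // => p _; rewrite logn1 mulr0.
  rewrite factS natrM lnM ?posrE ?ltr0n ?fact_gt0 // (IH (ltnW nN)).
  rewrite (@ln_prime_factors N n.+1) // -big_split; apply: eq_bigr => p _ /=.
  by rewrite lognM ?fact_gt0 // natrD mulrDr.
apply: eq_bigr => p pp; congr (_ * _).
by rewrite logn_fact // -(@sum_div_pow_widen N) ?prime_gt1 // natr_sum.
Qed.

(** The main term of ln x!.  Its derivative is ln, and every estimate below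
    follows from its convexity alone. *)
Definition stirling (x : R) : R := x * ln x - x.

Lemma ln_le_sub1 (x : R) : 0 < x -> ln x <= x - 1.
Proof. by move=> x0; rewrite -{1}(subrKC 1 x) le_ln1Dx //; lra. Qed.

Lemma stirling_tangent (x y : R) : 0 < x -> 0 < y ->
  (x - y) * ln y <= stirling x - stirling y.
Proof.
move=> x0 y0.
have : x * ln (y / x) <= x * (y / x - 1).
  by rewrite ler_wpM2l ?(ltW x0) // ln_le_sub1 // divr_gt0.
rewrite ln_div ?posrE // mulrBr mulrBr mulr1 mulrCA divff ?gt_eqF // mulr1.
rewrite /stirling; lra.
Qed.

Lemma ln_fact_ge n : (0 < n)%N -> stirling n%:R <= ln (n`!%:R : R).
Proof.
case: n => // n _; elim: n => [|n IH]; first by rewrite /stirling ln1; lra.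
rewrite factS natrM lnM ?posrE ?ltr0n ?fact_gt0 //.
have := @stirling_tangent n.+1%:R n.+2%:R (ltr0Sn _ _) (ltr0Sn _ _).
rewrite -[n.+2%:R]natr1; lra.
Qed.

Lemma ln_fact_le n : (0 < n)%N ->
  ln (n`!%:R : R) <= stirling n%:R + ln n%:R + 1.
Proof.
case: n => // n _; elim: n => [|n IH]; first by rewrite /stirling ln1; lra.
rewrite factS natrM lnM ?posrE ?ltr0n ?fact_gt0 //.
have := @stirling_tangent n.+2%:R n.+1%:R (ltr0Sn _ _) (ltr0Sn _ _).
rewrite -[n.+2%:R]natr1; lra.
Qed.

(** Replacing floor (m / d) by m / d moves the argument by less than 1, and the
    slope of the main term is at most ln m there.  When m < d the factorial is
    1 and the main term lies in [-1, 0]. *)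
Lemma ln_fact_div m d : (0 < m)%N -> (0 < d)%N ->
  `|ln ((m %/ d)`!%:R : R) - stirling (m%:R / d%:R)| <= ln m%:R + 1.
Proof.
move=> m0 d0; set n := (m %/ d)%N; set x : R := m%:R / d%:R.
have dR : 0 < d%:R :> R by rewrite ltr0n.
have x0 : 0 < x by rewrite divr_gt0 ?ltr0n.
have lnm0 := ln_nat_ge0 m.
have nx : n%:R <= x by rewrite ler_pdivlMr // -natrM ler_nat leq_trunc_div.
have xn : x < n%:R + 1 by rewrite ltr_pdivrMr // natr1 -natrM ltr_nat -ltn_divLR.
have xm : ln x <= ln m%:R.
  rewrite ler_ln ?posrE ?ltr0n // ler_pdivrMr // ler_peMr ?ler0n //.
  by rewrite ler1n.
have [n0|n0] := posnP n; last first.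
  have nR : 0 < n%:R :> R by rewrite ltr0n.
  have lnn0 := ln_nat_ge0 n.
  have lnx : ln n%:R <= ln x by rewrite ler_ln.
  have h1 := ln_fact_ge n n0; have h2 := ln_fact_le n n0.
  have t1 := stirling_tangent x n%:R x0 nR.
  have t2 := stirling_tangent n%:R x nR x0.
  have : 0 <= (x - n%:R) * ln n%:R by rewrite mulr_ge0 // subr_ge0.
  have : 0 <= (1 - (x - n%:R)) * ln x by rewrite mulr_ge0 //; lra.
  rewrite ler_norml; lra.
rewrite n0 fact0 ln1 sub0r normrN; rewrite n0 add0r in xn.
have := stirling_tangent x 1 x0 ltr01; have := stirling_tangent 1 x ltr01 x0.
have : x * ln x <= 0 by rewrite pmulr_rle0 // ln_le0 // ltW.
by rewrite /stirling ln1 ler_norml; lra.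
Qed.

(** An entry [(k, b_k)] stands for b_k k (u / k) rather than for b_k (u / k):
    the combination is bounded exactly when the b_k add up to 0, and then
    rescaled coefficients can be rounded to integers independently. *)
Definition floor_comb (b : seq (nat * R)) (u : nat) : R :=
  \sum_(x <- b) x.2 * (x.1 * (u %/ x.1))%:R.

Definition log_rate (b : seq (nat * R)) : R := - \sum_(x <- b) x.2 * ln x.1%:R.

(** The main term of ln (n / k)! is (n / k) (ln n - ln k - 1); multiplied by
    b_k k and summed over k, the part n (ln n - 1) is killed by the zero sum of
    the b_k and only - n b_k ln k remains. *)
Lemma mangoldt_sum_balanced N b n :
    all (fun x => 0 < x.1)%N b -> \sum_(x <- b) x.2 = 0 -> (0 < n <= N)%N ->
  `|mangoldt_sum N (floor_comb b) n - n%:R * log_rate b|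
    <= (\sum_(x <- b) `|x.2| * x.1%:R) * (ln n%:R + 1).
Proof.
move=> b0 bal /andP[n0 nN]; have nR : 0 < n%:R :> R by rewrite ltr0n.
have -> : mangoldt_sum N (floor_comb b) n =
    \sum_(x <- b) x.2 * x.1%:R * ln (n %/ x.1)`!%:R.
  rewrite mangoldt_sum_sum; apply: eq_bigr => x _.
  rewrite (@ln_fact N) ?(leq_trans (leq_div _ _)) // -mangoldt_sum_div.
  rewrite -mangoldt_sumZ; congr (mangoldt_sum N _ n); apply: funext => v.
  by rewrite natrM mulrA.
have -> : n%:R * log_rate b = \sum_(x <- b) x.2 * x.1%:R * stirling (n%:R / x.1%:R).
  have -> : n%:R * log_rate b =
      \sum_(x <- b) x.2 * (n%:R * (ln n%:R - 1) - n%:R * ln x.1%:R).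
    under [RHS]eq_bigr do rewrite mulrBr.
    rewrite sumrB -mulr_suml bal mul0r sub0r /log_rate mulrN mulr_sumr.
    by congr (- _); apply: eq_bigr => x _; rewrite mulrCA.
  rewrite [LHS]big_seq [RHS]big_seq; apply: eq_bigr => x xb.
  have x0 : 0 < x.1%:R :> R by rewrite ltr0n (allP b0).
  rewrite /stirling ln_div ?posrE //; field.
  by rewrite gt_eqF.
rewrite -sumrB (le_trans (ler_norm_sum _ _ _)) // mulr_suml.
rewrite [leLHS]big_seq [leRHS]big_seq; apply: ler_sum => x xb.
rewrite -mulrBr !normrM normr_nat.
by rewrite ler_wpM2l ?mulr_ge0 // ln_fact_div // (allP b0).
Qed.

(** Chebyshev's psi function, for n at most the cutoff. *)
Definition psi N n : R := mangoldt_sum N (fun v => (0 < v)%:R) n.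

Lemma psi_div N (q n : nat) :
  psi N (n %/ q) = mangoldt_sum N (fun v => (0 < v %/ q)%:R) n.
Proof. by rewrite /psi -mangoldt_sum_div. Qed.

Lemma psi0 N : psi N 0 = 0.
Proof.
rewrite /psi /mangoldt_sum big1 // => p _; rewrite big1 ?mulr0 // => k _.
by rewrite div0n.
Qed.

(** The minorant gives psi(n) - psi(n / q) <= A n + O(ln n); iterating n -> n / q
    sums a geometric series with ratio 1/q, and the at most ln n + 1 error terms
    give the squared logarithm.  The condition ln q >= 1 makes ln n drop by 1
    at each round. *)
Lemma psi_le_of_minorant N (f : nat -> R) (A E : R) q :
    (1 < q)%N -> 1 <= ln (q%:R : R) -> 0 <= A -> 0 <= E ->
    (forall v, (0 < v)%:R - (0 < v %/ q)%:R <= f v) ->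
    (forall n, (0 < n <= N)%N -> mangoldt_sum N f n <= A * n%:R + E * (ln n%:R + 1)) ->
  forall n, (0 < n <= N)%N ->
    psi N n <= A * (q%:R / (q%:R - 1)) * n%:R + E * (ln n%:R + 1) ^+ 2.
Proof.
move=> q1 lnq A0 E0 fge fle n; have [m] := ubnP n; elim: m n => // m IH n.
rewrite ltnS => nm /andP[n0 nN].
have qR : 1 < q%:R :> R by rewrite ltr1n.
set C := A * (q%:R / (q%:R - 1)).
have C0 : 0 <= C by rewrite mulr_ge0 // divr_ge0 ?ler0n // subr_ge0 ltW.
(* the minorant, summed against Lambda *)
have step : psi N n <= psi N (n %/ q) + (A * n%:R + E * (ln n%:R + 1)).
  rewrite -lerBlDl (le_trans _ (fle n _)) ?n0 // psi_div.
  rewrite -[- _]mulN1r -mangoldt_sumZ -mangoldt_sumD.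
  by apply: mangoldt_sum_le => v _; rewrite mulN1r fge.
apply: (le_trans step); have ln0 := ln_nat_ge0 n.
have CA : C * (n%:R / q%:R) + A * n%:R = C * n%:R.
  by rewrite /C; field; rewrite subr_eq0 !gt_eqF // (lt_trans _ qR).
have [nq0|nq0] := posnP (n %/ q).
  rewrite nq0 psi0 add0r -CA expr2.
  have : 0 <= C * (n%:R / q%:R) by rewrite mulr_ge0 // divr_ge0 ?ler0n.
  have : 0 <= E * (ln n%:R * (ln n%:R + 1)) by rewrite !mulr_ge0 // addr_ge0.
  lra.
have nqR : (n %/ q)%:R <= n%:R / q%:R :> R.
  by rewrite ler_pdivlMr ?(lt_trans _ qR) // -natrM ler_nat leq_trunc_div.
have lnnq : ln (n %/ q)%:R <= ln n%:R - 1 :> R.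
  apply: (@le_trans _ _ (ln (n%:R / q%:R))).
    by rewrite ler_ln // posrE ?divr_gt0 ?ltr0n // ltnW.
  by rewrite ln_div ?posrE ?ltr0n ?(ltnW q1) //; lra.
have nq_n : (n %/ q < n)%N by rewrite ltn_Pdiv.
have := IH (n %/ q)%N (leq_trans nq_n nm).
rewrite nq0 (leq_trans (ltnW nq_n) nN) => /(_ isT) IHq.
have := ler_wpM2l C0 nqR; have lnq0 := ln_nat_ge0 (n %/ q).
have : E * (ln (n %/ q)%:R + 1) ^+ 2 <= E * ln n%:R ^+ 2.
  rewrite ler_wpM2l // lerXn2r // ?nnegrE ?addr_ge0 //.
  by move: lnnq; rewrite lerBrDr.
have : 0 <= E * ln n%:R by rewrite mulr_ge0.
rewrite -/C in IHq; rewrite -CA; move: IHq; rewrite !expr2; lra.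
Qed.

End VonMangoldtSums.

Arguments mangoldt_sum {R}.
Arguments psi {R}.
Arguments floor_comb {R}.
Arguments log_rate {R}.

(** * From a majorant to a count of primes *)

Section PrimeCount.
Variable R : realType.
Implicit Types (n q p : nat).

Lemma count_leq m t : (\sum_(1 <= k < m.+1) (k <= t) = minn m t)%N.
Proof.
elim: m => [|m IH]; first by rewrite big_geq // min0n.
rewrite big_nat_recr //= IH; case: (leqP m.+1 t); lia.
Qed.

(** There are trunc_log p n powers of p up to n, and p to that power is still
    at most n. *)
Lemma sum_ln_prime_powers n p : (0 < n)%N -> prime p ->
  ln p%:R * \sum_(1 <= k < n.+1) ((p ^ k <= n)%N : nat)%:R <= ln n%:R :> R.
Proof.
move=> n0 pp; have p1 := prime_gt1 pp.
have tn : (trunc_log p n <= n)%N.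
  by rewrite (leq_trans _ (trunc_logP p1 n0)) // ltnW // ltn_expl.
rewrite -natr_sum.
have -> : (\sum_(1 <= k < n.+1) (p ^ k <= n) = trunc_log p n)%N.
  rewrite -[RHS](minn_idPr tn) -count_leq; apply: eq_bigr => k _; congr nat_of_bool.
  apply/idP/idP => [|kt]; first exact: trunc_log_max.
  by rewrite (leq_trans _ (trunc_logP p1 n0)) // leq_exp2l.
have p0 : 0 < p%:R :> R by rewrite ltr0n prime_gt0.
rewrite mulr_natr -lnXn // ler_ln ?posrE ?exprn_gt0 ?ltr0n ?(prime_gt0 pp) //.
by rewrite -natrX ler_nat trunc_logP.
Qed.

Lemma count_prime_squares n :
  \sum_(p < n.+1 | prime p) ((p ^ 2 <= n)%N : nat)%:R <= Num.sqrt (n%:R : R).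
Proof.
set t := Num.truncn (Num.sqrt (n%:R : R)).
have /andP[tle tgt] := truncn_itv (sqrtr_ge0 (n%:R : R)).
apply: le_trans tle; rewrite -natr_sum ler_nat.
have le_t p : (p ^ 2 <= n)%N -> (p <= t)%N.
  move=> p2; rewrite -ltnS -(ltr_nat R); apply: le_lt_trans tgt.
  rewrite -(ler_pXn2r (n := 2)) ?nnegrE ?sqrtr_ge0 //.
  by rewrite sqr_sqrtr // -natrX ler_nat.
apply: (@leq_trans (minn n t)); last exact: geq_minr.
rewrite -count_leq -(big_mkord prime (fun p => (p ^ 2 <= n)%N : nat)).
rewrite big_ltn_cond //= big_mkcond leq_sum // => p _.
by case: ifP => // _; case: (leqP (p ^ 2) n) => // /le_t ->.
Qed.

Definition primes_with_quotient n q : seq nat :=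
  [seq p <- iota 0 n.+1 | prime p && (n %/ p == q)%N].

(** Here n / d = q holds for primes d = p, which are counted with weight
    ln p <= ln n, or for proper powers of a prime p with p ^ 2 <= n; the powers
    of one such p weigh at most ln n together. *)
Lemma mangoldt_sum_quotient n q : (0 < n)%N -> (0 < q)%N ->
  mangoldt_sum n (fun v => (v == q)%:R) n <=
  ((size (primes_with_quotient n q))%:R + Num.sqrt n%:R) * ln n%:R :> R.
Proof.
move=> n0 q0; rewrite mulrDl.
have -> : (size (primes_with_quotient n q))%:R =
    \sum_(p < n.+1 | prime p) ((n %/ p == q)%N : nat)%:R :> R.
  rewrite size_filter -sum1_count -natr_sum -[iota _ _]/(index_iota 0 n.+1).
  by rewrite big_mkord big_mkcondr; congr _%:R; apply: eq_bigr => p _; case: eqP.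
apply: (@le_trans _ _ (\sum_(p < n.+1 | prime p)
    (((n %/ p == q)%N : nat)%:R + ((p ^ 2 <= n)%N : nat)%:R) * ln n%:R)); last first.
  rewrite -mulr_suml big_split mulrDl /= lerD2l.
  by rewrite ler_wpM2r ?ln_nat_ge0 ?count_prime_squares.
apply: ler_sum => p pp; have p1 := prime_gt1 pp.
rewrite big_nat_recl // expn1 mulrDr mulrDl lerD //.
  rewrite mulrC; case: eqP => [_|]; last by rewrite !mul0r.
  have p0 := prime_gt0 pp; rewrite ler_wpM2l // ler_ln ?posrE ?ltr0n // ler_nat.
  by rewrite -ltnS ltn_ord.
have [p2|p2] := leqP.
  rewrite mul1r; apply: le_trans (@sum_ln_prime_powers _ p n0 pp).
  rewrite ler_wpM2l ?ln_nat_ge0 // [leRHS]big_nat_recl // ler_wpDl ?ler0n //.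
  apply: ler_sum => k _; rewrite ler_nat; case: eqP => // nq.
  rewrite [(_ <= n)%N]leqNgt; case: ltnP => // np.
  by rewrite -nq divn_small in q0.
rewrite mul0r big1_seq ?mulr0 // => k; rewrite mem_index_iota => /andP[_ /andP[k1 _]].
have npk : (n < p ^ k.+1)%N by rewrite (leq_trans p2) // leq_exp2l.
by rewrite divn_small // eq_sym (gtn_eqF q0).
Qed.

(** Both sides of the majorant are summed against Lambda.  On the left,
    n / 15 and n / 16 give the rate (1/15 - 1/16) B = B / 240; this is the
    reason for the factor 240 in the positions of the steps, which makes the
    comparison of the two sides free of it. *)
Lemma sieve_lower_bound (b w : seq (nat * R)) (M c E : R) :
    all (fun x => 0 < x.1)%N b -> \sum_(x <- b) x.2 = 0 ->
    all (fun x => (0 < x.1)%N && (0 <= x.2)) w -> 0 <= M -> 0 <= E -> 0 <= c ->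
    (forall v, floor_comb b (v %/ 15)%N - floor_comb b (v %/ 16)%N <=
       M * (v == 15)%:R + \sum_(x <- w) x.2 * (0 < v %/ (240 * x.1))%N%:R) ->
    (forall N n, (0 < n <= N)%N -> psi N n <= c * n%:R + E * (ln n%:R + 1) ^+ 2) ->
    0 <= log_rate b ->
  exists K : R, 0 <= K /\ forall n, (16 <= n)%N ->
    (log_rate b - c * \sum_(x <- w) x.2 / x.1%:R) / 240 * n%:R <=
    M * ((size (primes_with_quotient n 15))%:R + Num.sqrt n%:R) * ln n%:R
      + K * (ln n%:R + 1) ^+ 2.
Proof.
move=> b0 bal w0 M0 E0 c0 maj psile B0.
set B := log_rate b; set D := \sum_(x <- b) `|x.2| * x.1%:R.
have D0 : 0 <= D by apply: sumr_ge0 => x _; rewrite mulr_ge0.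
have W0 : 0 <= \sum_(x <- w) x.2.
  by rewrite big_seq; apply: sumr_ge0 => x /(allP w0)/andP[].
exists (B + 2 * D + E * \sum_(x <- w) x.2); split.
  by rewrite !addr_ge0 // mulr_ge0.
move=> n n16; have n0 : (0 < n)%N by apply: leq_trans n16.
have lnn := ln_nat_ge0 R n; set L := ln n%:R + 1; have L1 : 1 <= L by rewrite /L; lra.
have LL : L <= L ^+ 2 by rewrite expr2 ler_peMl //; lra.
have near q : (0 < q <= 16)%N ->
    `|mangoldt_sum n (floor_comb b) (n %/ q) - (n %/ q)%:R * B| <= D * L.
  case/andP=> q0 q16; have nq0 : (0 < n %/ q)%N by rewrite divn_gt0 // (leq_trans q16).
  apply: le_trans (mangoldt_sum_balanced _ _ _ _ b0 bal _) _.
    by rewrite nq0 leq_div.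
  by rewrite ler_wpM2l // lerD2r ler_ln ?posrE ?ltr0n // ler_nat leq_div.
have lower : n%:R * B / 240 - B - 2 * D * L <=
    mangoldt_sum n (fun v => floor_comb b (v %/ 15)%N - floor_comb b (v %/ 16)%N) n.
  have -> : mangoldt_sum n (fun v => floor_comb b (v %/ 15)%N - floor_comb b (v %/ 16)%N) n
    = mangoldt_sum n (floor_comb b) (n %/ 15) - mangoldt_sum n (floor_comb b) (n %/ 16).
    rewrite -!mangoldt_sum_div -[- _]mulN1r -mangoldt_sumZ -mangoldt_sumD.
    by congr (mangoldt_sum _ _ _); apply: funext => v; rewrite mulN1r.
  have := near 15%N isT; have := near 16%N isT; rewrite !ler_norml.
  have le16 : (n %/ 16)%:R * 16 <= n%:R :> R by rewrite -natrM ler_nat leq_trunc_div.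
  have ge15 : n%:R <= (n %/ 15)%:R * 15 + 15 :> R.
    by rewrite -natrM -natrD ler_nat -mulSnr ltnW // -ltn_divLR.
  have := ler_wpM2r B0 le16; have := ler_wpM2r B0 ge15; rewrite -/B.
  lra.
have upper : mangoldt_sum n (fun v => floor_comb b (v %/ 15)%N - floor_comb b (v %/ 16)%N) n
    <= M * ((size (primes_with_quotient n 15))%:R + Num.sqrt n%:R) * ln n%:R
     + c * (\sum_(x <- w) x.2 / x.1%:R) / 240 * n%:R + E * (\sum_(x <- w) x.2) * L ^+ 2.
  apply: le_trans (mangoldt_sum_le _ _ _ _ _ (fun v _ => maj v)) _.
  rewrite mangoldt_sumD mangoldt_sumZ mangoldt_sum_sum -addrA lerD //.
    by rewrite -mulrA ler_wpM2l // mangoldt_sum_quotient.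
  have -> : c * (\sum_(x <- w) x.2 / x.1%:R) / 240 * n%:R
      + E * (\sum_(x <- w) x.2) * L ^+ 2 =
      \sum_(x <- w) x.2 * (c * (n%:R / (240 * x.1%:R)) + E * L ^+ 2).
    transitivity (\sum_(x <- w) (x.2 / x.1%:R * (c / 240 * n%:R) + x.2 * (E * L ^+ 2))).
      by rewrite big_split -!mulr_suml /=; ring.
    rewrite [LHS]big_seq [RHS]big_seq; apply: eq_bigr => x /(allP w0)/andP[x0 _].
    by field; rewrite pnatr_eq0 -lt0n.
  rewrite [leLHS]big_seq [leRHS]big_seq; apply: ler_sum => x /(allP w0)/andP[x0 x20].
  rewrite mangoldt_sumZ -psi_div.
  rewrite ler_wpM2l //; have xR : 0 < x.1%:R :> R by rewrite ltr0n.
  set m := (n %/ _)%N.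
  have mn : m%:R <= n%:R / (240 * x.1%:R) :> R.
    by rewrite ler_pdivlMr ?mulr_gt0 // -[240]/(240%:R) -!natrM ler_nat leq_trunc_div.
  have [m0|m0] := posnP m.
    have L0 : 0 <= L by lra.
    by rewrite m0 psi0 addr_ge0 ?mulr_ge0 ?exprn_ge0 ?invr_ge0 ?mulr_ge0.
  apply: le_trans (psile n m _) _; first by rewrite m0 leq_div.
  rewrite lerD ?ler_wpM2l // lerXn2r ?nnegrE ?addr_ge0 ?ln_nat_ge0 //.
  by rewrite lerD2r ler_ln ?posrE ?ltr0n // ler_nat leq_div.
have := le_trans lower upper.
have := ler_wpM2l B0 (le_trans L1 LL); have := ler_wpM2l D0 LL; rewrite -/B mulr1.
lra.
Qed.

(** With t = n ^ (1/4), both ln n and ln n + 1 are at most 4 t, so that if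
    u n < N the right side is O(t ^ 3), less than k t ^ 4 for large t. *)
Lemma eventually_many (u : nat -> nat) (k M K : R) : 0 < k -> 0 <= M -> 0 <= K ->
    (forall n, (16 <= n)%N ->
      k * n%:R <= M * ((u n)%:R + Num.sqrt n%:R) * ln n%:R + K * (ln n%:R + 1) ^+ 2) ->
  forall N, exists n0, forall n, (n0 <= n)%N -> (N <= u n)%N.
Proof.
move=> k0 M0 K0 uP N; set Q : R := 4 * M * N%:R + 4 * M + 16 * K.
have Q0 : 0 <= Q by rewrite !addr_ge0 ?mulr_ge0.
(* T exceeds Q / k, and is at least 2 so that T ^ 4 >= 16 *)
set T := (Num.truncn (Q / k)).+2; exists (T ^ 4)%N => n Tn.
rewrite leqNgt; apply/negP => uN.
have T4 : (2 ^ 4 <= T ^ 4)%N by rewrite leq_exp2r.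
have n16 : (16 <= n)%N by apply: leq_trans Tn.
have nR : 0 <= n%:R :> R by [].
set t := Num.sqrt (Num.sqrt (n%:R : R)).
have t0 : 0 <= t := sqrtr_ge0 _.
have t2 : t ^+ 2 = Num.sqrt n%:R by rewrite sqr_sqrtr ?sqrtr_ge0.
have t4 : t ^+ 4 = n%:R by rewrite (exprM t 2 2) t2 sqr_sqrtr.
have Tt : T%:R <= t.
  by rewrite -(@ler_pXn2r _ 4) ?nnegrE // t4 -natrX ler_nat.
have t1 : 1 < t by apply: lt_le_trans Tt; rewrite ltr1n.
have Qt : Q < k * t.
  rewrite mulrC -ltr_pdivrMr //; apply: lt_le_trans Tt.
  by rewrite (lt_trans (truncnS_gt (Q / k))) // ltr_nat.
have lnt : ln n%:R <= 4 * (t - 1).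
  have tp : 0 < t by lra.
  by rewrite -t4 lnXn // -[_ t *+ 4]mulr_natl ler_wpM2l // ln_le_sub1.
have ln0 := ln_nat_ge0 R n; have := uP n n16.
apply/negP; rewrite -ltNge -t2 -t4.
have u_le : (u n)%:R + t ^+ 2 <= N%:R + t ^+ 2.
  by rewrite lerD2r ler_nat ltnW.
have h1 : M * ((u n)%:R + t ^+ 2) * ln (t ^+ 4) <= M * (N%:R + t ^+ 2) * (4 * t).
  apply: ler_pM; rewrite ?t4 ?mulr_ge0 ?addr_ge0 ?exprn_ge0 ?ler_wpM2l //; lra.
have h2 : K * (ln (t ^+ 4) + 1) ^+ 2 <= K * (4 * t) ^+ 2.
  rewrite ler_wpM2l // lerXn2r ?nnegrE ?t4 ?addr_ge0 ?mulr_ge0 //; lra.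
apply: le_lt_trans (lerD h1 h2) _.
have h3 : M * (N%:R + t ^+ 2) * (4 * t) + K * (4 * t) ^+ 2 <= Q * t ^+ 3.
  have tt : t <= t ^+ 3 by rewrite -{1}[t]expr1 ler_weXn2l // ltW.
  have tt2 : t ^+ 2 <= t ^+ 3 by rewrite ler_weXn2l // ltW.
  have := ler_wpM2l K0 tt2; have MN0 : 0 <= M * N%:R by rewrite mulr_ge0.
  have := ler_wpM2l MN0 tt; rewrite /Q; lra.
apply: le_lt_trans h3 _; have t3 : 0 < t ^+ 3 by rewrite exprn_gt0 //; lra.
by rewrite (exprS t 3) (mulrA k) ltr_pM2r.
Qed.

Lemma primes_with_quotientP (n q p : nat) :
  p \in primes_with_quotient n q -> prime p /\ (n %/ p = q)%N.
Proof. by rewrite mem_filter => /andP[/andP[pp /eqP]]. Qed.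

(** Take n = floor (240 x): 15 p <= n gives p <= 16 x, and n + 1 <= 16 p gives
    p >= 15 x. *)
Lemma primes_between_of_quotient (N : nat) :
    (exists n0, forall n, (n0 <= n)%N -> (N <= size (primes_with_quotient n 15))%N) ->
  exists L : nat, (0 < L)%N /\
    forall x : R, L%:R <= x ->
      `I_N #<= [set p : nat | prime p /\ 15 * x <= p%:R <= 16 * x].
Proof.
case=> n0 hn0; exists n0.+1; split=> // x Lx.
have x0 : 0 <= x by apply: le_trans Lx.
set n := Num.truncn (240 * x).
have /andP[nx xn] : n%:R <= 240 * x < n.+1%:R by rewrite truncn_itv // mulr_ge0.
have nn0 : (n0 <= n)%N.
  rewrite truncn_ge_nat ?mulr_ge0 //; move: Lx; rewrite -natr1; lra.
set s := primes_with_quotient n 15; have sN : (N <= size s)%N := hn0 n nn0.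
apply/pcard_surjP; exists (index^~ s) => i /= iN.
have is_ : (i < size s)%N := leq_trans iN sN.
exists (nth 0%N s i); last by rewrite index_uniq // filter_uniq ?iota_uniq.
have [pp npq] := primes_with_quotientP _ _ _ (mem_nth 0%N is_).
split=> //; set p := nth _ _ _ in pp npq *.
have p0 := prime_gt0 pp.
have le15 : (15 * p <= n)%N by rewrite -npq leq_trunc_div.
have lt16 : (n.+1 <= 16 * p)%N by rewrite -ltn_divLR // npq.
move: le15 lt16; rewrite -!(ler_nat R) !natrM; lra.
Qed.

End PrimeCount.

(** * Checking the majorant by computation *)

Section IntegerCombs.
Implicit Types (b w : seq (nat * Z)) (u v s : nat).

Lemma Z_of_natE n : Z.of_nat n = n%:R.
Proof. exact: (ssrZ.Instances.Z_of_intE (Posz n)). Qed.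

Definition int_floor_comb b u : Z := \sum_(x <- b) x.2 * (x.1 * (u %/ x.1))%:R.

(** A state holds, for each period k, the triple (k - 1, number of increments of
    u before the next multiple of k is one increment away, k b_k).  Advancing u
    by one then needs no division: it returns the jump of the combination,
    the sum of k b_k over the k dividing u + 1, and the new state. *)
Fixpoint advance (st : seq (nat * nat * Z)) : Z * seq (nat * nat * Z) :=
  if st is (p, r, c) :: st' then
    let (d, l) := advance st' in
    if r is r'.+1 then (d, (p, r', c) :: l) else (Z.add c d, (p, p, c) :: l)
  else (Z0, [::]).

Fixpoint tabulate n st (f : Z) : seq Z :=
  if n is n'.+1 then
    f :: (let (d, st') := advance st in tabulate n' st' (Z.add f d))
  else [::].

Definition counters b u : seq (nat * nat * Z) :=
  [seq (x.1.-1, x.1.-1 - u %% x.1, Z.mul x.2 (Z.of_nat x.1))%N | x <- b].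

Lemma advance_counters b u : all (fun x => 0 < x.1)%N b ->
  advance (counters b u) = (int_floor_comb b u.+1 - int_floor_comb b u, counters b u.+1).
Proof.
elim: b => [_|[k c] b IH /= /andP[k0 b0]].
  by rewrite /int_floor_comb !big_nil subrr.
rewrite IH // /int_floor_comb !big_cons /= divnS // modnS; case: k k0 => // k _ /=.
have um : (u %% k.+1 <= k)%N by rewrite -ltnS ltn_pmod.
have dvdE : (k.+1 %| u.+1)%N = (u %% k.+1 == k)%N.
  rewrite /dvdn -addn1 -modnDml addn1; case: eqP => [/eqP|] h.
    by rewrite eqn_leq um -ltnS dvdn_leq.
  by apply/esym/eqP => hk; rewrite hk modnn in h.
rewrite dvdE; case: eqP => [->|uk].
  rewrite subnn subn0; congr (_, _ :: _).
  have -> : Z.mul c (Z.of_nat k.+1) = c * k.+1%:R by rewrite Z_of_natE.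
  rewrite (_ : forall x y : Z, Z.add x y = x + y) // mulnDr muln1 natrD; ring.
have -> : (k - u %% k.+1 = (k - (u %% k.+1).+1).+1)%N by lia.
by congr (_, _ :: _); rewrite add0n; ring.
Qed.

Lemma nth_tabulate b n u i : all (fun x => 0 < x.1)%N b -> (i < n)%N ->
  nth 0 (tabulate n (counters b u) (int_floor_comb b u)) i = int_floor_comb b (u + i).
Proof.
move=> b0; elim: n u i => // n IH u [|i] /= ni; first by rewrite addn0.
rewrite advance_counters // -addSnnS -IH //.
by congr (nth _ (tabulate _ _ _) _); exact: subrKC.
Qed.

(** As 240 = 15 * 16, for v = 240 s + z the quotients by 15 and 16 are
    16 s + z / 15 and 15 s + z / 16: in each block of 240 values of v, only these
    pairs of offsets occur. *)
Definition offsets : seq (nat * nat) :=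
  undup [seq (z %/ 15, z %/ 16)%N | z <- iota 0 240].

(** A sum that reduces under computation, unlike the big operators. *)
Definition zsum (f : nat * Z -> Z) (l : seq (nat * Z)) : Z :=
  foldr (fun x a => Z.add (f x) a) Z0 l.

Lemma zsumE f l : zsum f l = \sum_(x <- l) f x.
Proof. by elim: l => [|x l IH]; rewrite ?big_nil // big_cons -IH. Qed.

Definition step_sum w s : Z := zsum (fun x => if (x.1 <= s)%N then x.2 else Z0) w.

(** The lists hold the values of the combination from indices 16 s and 15 s on.
    The step function is constant on each block; the peak v = 15 is the pair of
    offsets (1, 0) of block 0. *)
Fixpoint check_blocks (m : Z) w n s (l15 l16 : seq Z) : bool :=
  if n is n'.+1 then
    all (fun ij => Z.leb (Z.sub (nth Z0 l15 ij.1) (nth Z0 l16 ij.2))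
           (if (s == 0)%N && (ij == (1, 0)%N) then Z.add m (step_sum w s)
            else step_sum w s)) offsets
    && check_blocks m w n' s.+1 (drop 16 l15) (drop 15 l16)
  else true.

Arguments offsets : simpl never.

Lemma check_blocksS m w n s l15 l16 : check_blocks m w n.+1 s l15 l16 =
    all (fun ij => Z.leb (Z.sub (nth Z0 l15 ij.1) (nth Z0 l16 ij.2))
           (if (s == 0)%N && (ij == (1, 0)%N) then Z.add m (step_sum w s)
            else step_sum w s)) offsets
    && check_blocks m w n s.+1 (drop 16 l15) (drop 15 l16).
Proof. by []. Qed.

Lemma step_sumE w s : step_sum w s = \sum_(x <- w) x.2 * (x.1 <= s)%N%:R.
Proof.
rewrite /step_sum zsumE; apply: eq_bigr => x _.
by case: ifP => _; rewrite ?mulr1 ?mulr0.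
Qed.

Lemma check_blocksP m w n s l15 l16 : check_blocks m w n s l15 l16 ->
  forall i z, (i < n)%N -> (z < 240)%N ->
    nth 0 l15 (16 * i + z %/ 15) - nth 0 l16 (15 * i + z %/ 16) <=
    m * ((s + i == 0) && (z == 15))%N%:R + step_sum w (s + i) :> Z.
Proof.
elim: n s l15 l16 => [|n IH] s l15 l16; first by move=> _ i z; rewrite ltn0.
rewrite check_blocksS => /andP[chk rest] [|i] z ni z240.
  have zin : (z %/ 15, z %/ 16)%N \in offsets.
    rewrite mem_undup; apply: (map_f (fun z => (z %/ 15, z %/ 16)%N)).
    by rewrite mem_iota.
  have {chk} /= := allP chk _ zin; rewrite !muln0 !add0n addn0.
  have -> : ((z %/ 15, z %/ 16)%N == (1, 0)%N) = (z == 15%N).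
    apply/eqP/eqP => [[]|-> //]; lia.
  rewrite -/(_ <= _); case: ifP => _; rewrite ?mulr1 ?mulr0 ?add0r; exact.
have := IH _ _ _ rest i z ni z240.
by rewrite !nth_drop !mulnS !addnA -addSnnS.
Qed.

(** This form shows that the combination is bounded. *)
Lemma int_floor_comb_balanced b u : \sum_(x <- b) x.2 = 0 ->
  int_floor_comb b u = - \sum_(x <- b) x.2 * (u %% x.1)%:R.
Proof.
move=> bal; apply/eqP; rewrite -addr_eq0 /int_floor_comb -big_split /=.
rewrite (eq_bigr (fun x => x.2 * u%:R)) -?mulr_suml ?bal ?mul0r // => x _.
by rewrite -mulrDr -natrD mulnC -divn_eq.
Qed.

Lemma int_floor_comb_diff_le b u v :
    all (fun x => 0 < x.1)%N b -> \sum_(x <- b) x.2 = 0 ->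
  int_floor_comb b u - int_floor_comb b v <= \sum_(x <- b) `|x.2| * x.1.-1%:R.
Proof.
move=> b0 bal; rewrite !int_floor_comb_balanced // opprK addrC -sumrB.
rewrite [leLHS]big_seq [leRHS]big_seq; apply: ler_sum => x /(allP b0) x0.
rewrite -mulrBr (le_trans (ler_norm _)) // normrM ler_wpM2l //.
have um := ltn_pmod u x0; have vm := ltn_pmod v x0.
have um' : (u %% x.1)%:R <= x.1.-1%:R :> Z by rewrite ler_nat -ltnS prednK.
have vm' : (v %% x.1)%:R <= x.1.-1%:R :> Z by rewrite ler_nat -ltnS prednK.
have u0 := ler0n Z (u %% x.1); have v0 := ler0n Z (v %% x.1).
by rewrite ler_norml; lra.
Qed.

(** Beyond the tabulated blocks all steps have been passed, and the last of them
    is so large that their total reaches the trivial bound on the difference. *)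
Lemma certified_difference_le b w (m : Z) n :
    all (fun x => 0 < x.1)%N b -> \sum_(x <- b) x.2 = 0 ->
    all (fun x => 0 < x.1 <= n)%N w ->
    \sum_(x <- b) `|x.2| * x.1.-1%:R <= \sum_(x <- w) x.2 -> 0 <= m ->
    check_blocks m w n 0 (tabulate (16 * n) (counters b 0) 0)
      (tabulate (15 * n) (counters b 0) 0) ->
  forall v, int_floor_comb b (v %/ 15) - int_floor_comb b (v %/ 16) <=
    m * (v == 15)%N%:R + \sum_(x <- w) x.2 * (0 < v %/ (240 * x.1))%N%:R.
Proof.
move=> b0 bal w0 wtail m0 chk v.
have -> : \sum_(x <- w) x.2 * (0 < v %/ (240 * x.1))%N%:R = step_sum w (v %/ 240).
  rewrite step_sumE [LHS]big_seq [RHS]big_seq; apply: eq_bigr => x.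
  by move=> /(allP w0)/andP[x0 _]; rewrite divnMA divn_gt0.
have z0 : int_floor_comb b 0 = 0.
  by rewrite /int_floor_comb big1 // => x _; rewrite div0n muln0 mulr0.
have nth0_tabulate N i : (i < N)%N ->
    nth 0 (tabulate N (counters b 0) 0) i = int_floor_comb b i.
  by move=> iN; rewrite -[i in RHS]add0n -(@nth_tabulate b N 0 i) // z0.
(* beyond the table, the total of the steps dominates *)
have [vn|vn] := ltnP (v %/ 240) n; last first.
  apply: le_trans (int_floor_comb_diff_le _ _ _ b0 bal) _; apply: le_trans wtail _.
  rewrite ler_wpDl ?mulr_ge0 // step_sumE big_seq [leRHS]big_seq.
  apply: ler_sum => x /(allP w0)/andP[_ xn].
  by rewrite (leq_trans xn vn) mulr1.
have z240 := ltn_pmod v (isT : 0 < 240)%N.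
have := check_blocksP _ _ _ _ _ _ chk _ _ vn z240.
rewrite !nth0_tabulate //; [|lia|lia].
have -> : (16 * (v %/ 240) + (v %% 240) %/ 15 = v %/ 15)%N by lia.
have -> : (15 * (v %/ 240) + (v %% 240) %/ 16 = v %/ 16)%N by lia.
by have -> : ((v %/ 240 == 0) && (v %% 240 == 15) = (v == 15))%N by lia.
Qed.

End IntegerCombs.

(** * Comparing logarithmic rates *)

Section IntegersInReals.
Variable R : realType.

Definition real_of_Z : Z -> R := intr \o int_of_Z.
HB.instance Definition _ := GRing.RMorphism.copy real_of_Z (intr \o int_of_Z).

Lemma real_of_Z_le x y : (real_of_Z x <= real_of_Z y) = (x <= y).
Proof. by rewrite /real_of_Z /= ler_int; apply/idP/idP; lia. Qed.

Lemma real_of_Z_of_nat n : real_of_Z (Z.of_nat n) = n%:R.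
Proof. by rewrite Z_of_natE rmorph_nat. Qed.

Lemma real_of_ZN x : real_of_Z (Z.opp x) = - real_of_Z x. Proof. exact: rmorphN. Qed.

Lemma real_of_ZM x y : real_of_Z (Z.mul x y) = real_of_Z x * real_of_Z y.
Proof. exact: rmorphM. Qed.

Lemma real_of_Z_pow (a : Z) (n : nat) : real_of_Z (Z.pow a (Z.of_nat n)) = real_of_Z a ^+ n.
Proof.
elim: n => [|n IH]; first by rewrite expr0 -(rmorph1 real_of_Z).
by rewrite Nat2Z.inj_succ Z.pow_succ_r ?exprS -?IH -?rmorphM //; lia.
Qed.

Definition real_comb (b : seq (nat * Z)) : seq (nat * R) :=
  [seq (x.1, real_of_Z x.2) | x <- b].

Lemma floor_comb_real b u : floor_comb (real_comb b) u = real_of_Z (int_floor_comb b u).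
Proof.
rewrite /floor_comb big_map rmorph_sum; apply: eq_bigr => x _ /=.
by rewrite [RHS]rmorphM rmorph_nat.
Qed.

Lemma real_comb_balanced b : zsum snd b = Z0 -> \sum_(x <- real_comb b) x.2 = 0.
Proof. by rewrite zsumE big_map -(rmorph_sum real_of_Z) => ->; rewrite rmorph0. Qed.

Lemma log2_le_ln k : (0 < k)%N ->
  real_of_Z (Z.log2 (Z.pow (Z.of_nat k) 16)) * ln 2 <= 16 * ln k%:R.
Proof.
move=> k0; set a := Z.pow _ _.
have a0 : Z.lt 0 a by apply: Z.pow_pos_nonneg; lia.
have [+ _] := Z.log2_spec a a0; set l := Z.log2 a.
have l0 : Z.le 0 l := Z.log2_nonneg a.
rewrite -(Z2Nat.id _ l0) real_of_Z_of_nat => /Z.leb_le.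
rewrite -[Z.leb _ _]/(_ <= _ :> Z) -real_of_Z_le real_of_Z_pow.
rewrite [real_of_Z a](@real_of_Z_pow _ 16) real_of_Z_of_nat.
rewrite (_ : real_of_Z 2 = 2) // => le2.
have k0R : 0 < k%:R :> R by rewrite ltr0n.
rewrite !mulr_natl -!lnXn // ler_ln ?posrE ?exprn_gt0 //.
Qed.

Lemma ln_le_log2_up k : (0 < k)%N ->
  16 * ln k%:R <= real_of_Z (Z.log2_up (Z.pow (Z.of_nat k) 16)) * ln 2.
Proof.
move=> k0; set a := Z.pow _ _.
have a0 : Z.lt 0 a by apply: Z.pow_pos_nonneg; lia.
have [_ +] := Z.log2_log2_up_spec a a0; set l := Z.log2_up a.
have l0 : Z.le 0 l := Z.log2_up_nonneg a.
rewrite -(Z2Nat.id _ l0) real_of_Z_of_nat => /Z.leb_le.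
rewrite -[Z.leb _ _]/(_ <= _ :> Z) -real_of_Z_le real_of_Z_pow.
rewrite [real_of_Z a](@real_of_Z_pow _ 16) real_of_Z_of_nat.
rewrite (_ : real_of_Z 2 = 2) // => le2.
have k0R : 0 < k%:R :> R by rewrite ltr0n.
rewrite !mulr_natl -!lnXn // ler_ln ?posrE ?exprn_gt0 //.
Qed.

(** Bounds on the rate - sum_k b_k ln k, in units of (ln 2) / 16. *)
Definition rate_lower (b : seq (nat * Z)) : Z :=
  zsum (fun x => let p := Z.pow (Z.of_nat x.1) 16 in
    Z.opp (Z.mul x.2 (if Z.leb 0 x.2 then Z.log2_up p else Z.log2 p))) b.

Definition rate_upper (b : seq (nat * Z)) : Z :=
  zsum (fun x => let p := Z.pow (Z.of_nat x.1) 16 in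
    Z.opp (Z.mul x.2 (if Z.leb 0 x.2 then Z.log2 p else Z.log2_up p))) b.

Lemma rate_lower_le b : all (fun x => 0 < x.1)%N b ->
  real_of_Z (rate_lower b) * ln 2 <= 16 * log_rate (real_comb b).
Proof.
move=> b0; rewrite /rate_lower zsumE /log_rate big_map -sumrN rmorph_sum.
rewrite mulr_suml mulr_sumr [leLHS]big_seq [leRHS]big_seq.
apply: ler_sum => x /(allP b0) x0 /=.
rewrite real_of_ZN real_of_ZM !mulNr mulrN lerN2 mulrCA -mulrA.
case: ifP => xs.
  by rewrite ler_wpM2l ?ln_le_log2_up // -(rmorph0 real_of_Z) real_of_Z_le.
rewrite ler_wnM2l ?log2_le_ln // -(rmorph0 real_of_Z) real_of_Z_le.
lia.
Qed.

Lemma rate_upper_ge b : all (fun x => 0 < x.1)%N b ->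
  16 * log_rate (real_comb b) <= real_of_Z (rate_upper b) * ln 2.
Proof.
move=> b0; rewrite /rate_upper zsumE /log_rate big_map -sumrN rmorph_sum.
rewrite mulr_suml mulr_sumr [leLHS]big_seq [leRHS]big_seq.
apply: ler_sum => x /(allP b0) x0 /=.
rewrite real_of_ZN real_of_ZM !mulNr mulrN lerN2 mulrCA -mulrA.
case: ifP => xs.
  by rewrite ler_wpM2l ?log2_le_ln // -(rmorph0 real_of_Z) real_of_Z_le.
rewrite ler_wnM2l ?ln_le_log2_up // -(rmorph0 real_of_Z) real_of_Z_le.
lia.
Qed.

Lemma log_rate_ge0 b : all (fun x => 0 < x.1)%N b -> 0 <= rate_lower b ->
  0 <= log_rate (real_comb b).
Proof.
move=> b0; rewrite -real_of_Z_le rmorph0 => r0.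
have ln2 : 0 < ln 2 :> R by rewrite ln_gt0 // ltr1n.
have := rate_lower_le b b0; have := mulr_ge0 r0 (ltW ln2); lra.
Qed.

(** [S] clears the denominators of the w_i / s_i.  The factor 25 comes from
    c = (6/5) (rate of the Chebyshev combination) / 30. *)
Lemma log_rate_gap b c w S :
    all (fun x => 0 < x.1)%N b -> all (fun x => 0 < x.1)%N c ->
    (0 < S)%N -> all (fun x => x.1 %| S)%N w -> all (fun x => 0 <= x.2) w ->
    rate_upper c * zsum (fun x => Z.mul x.2 (Z.of_nat (S %/ x.1))) w
      < rate_lower b * Z.of_nat (25 * S) ->
  log_rate (real_comb c) * \sum_(x <- real_comb w) x.2 / x.1%:R
    < 25 * log_rate (real_comb b).
Proof.
move=> b0 c0 S0 wS w0; set V := zsum _ _; rewrite ltNge -real_of_Z_le -ltNge => gap0.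
have gap : real_of_Z (rate_upper c) * real_of_Z V < real_of_Z (rate_lower b) * (25 * S%:R).
  by rewrite -natrM -real_of_Z_of_nat -!real_of_ZM.
have SR : 0 < S%:R :> R by rewrite ltr0n.
have ln2 : 0 < ln 2 :> R by rewrite ln_gt0 // ltr1n.
have VE : real_of_Z V = S%:R * \sum_(x <- real_comb w) x.2 / x.1%:R.
  rewrite /V zsumE rmorph_sum big_map mulr_sumr [LHS]big_seq [RHS]big_seq.
  apply: eq_bigr => x xw /=; rewrite real_of_ZM real_of_Z_of_nat.
  have xS := allP wS _ xw; have x0 : (0 < x.1)%N := dvdn_gt0 S0 xS.
  rewrite -{2}(divnK xS) natrM; field.
  by rewrite pnatr_eq0 -lt0n.
have V0 : 0 <= real_of_Z V.
  rewrite /V zsumE rmorph_sum big_seq sumr_ge0 // => x xw /=.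
  by rewrite real_of_ZM real_of_Z_of_nat mulr_ge0 // -(rmorph0 real_of_Z) real_of_Z_le (allP w0).
rewrite -(ltr_pM2l SR) mulrCA -VE.
have up := ler_wpM2r V0 (rate_upper_ge c c0).
have lo : real_of_Z (rate_lower b) * ln 2 * (25 * S%:R) <=
    16 * log_rate (real_comb b) * (25 * S%:R).
  by rewrite ler_wpM2r ?rate_lower_le // mulr_ge0.
rewrite -(ltr_pM2r ln2) in gap; move: up lo gap; lra.
Qed.

End IntegersInReals.

(** * The coefficients *)

Section Certificate.
Local Open Scope Z_scope.

(** The first coefficients are 1000 mu(k) / k, rounded so that the combination
    never increases from 1 to 46: any increase there would cost a step
    of small start.  The later ones make the difference flat over a long range
    and the sum zero. *)
Definition sieve_weights : seq (nat * Z) := [::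
  (1%N, 1000); (2%N, -500); (3%N, -334); (5%N, -200); (6%N, 167);
  (7%N, -143); (10%N, 100); (11%N, -91); (13%N, -77); (14%N, 71); (15%N, 66);
  (17%N, -59); (19%N, -53); (21%N, 47); (22%N, 45); (23%N, -44); (26%N, 38);
  (29%N, -35); (30%N, -33); (31%N, -33); (33%N, 30); (34%N, 20); (35%N, 28);
  (37%N, -28); (38%N, 26); (39%N, 25); (41%N, -25); (42%N, -24); (43%N, -24);
  (46%N, 15); (47%N, -13); (48%N, 6); (49%N, -2); (51%N, 20); (52%N, -8);
  (55%N, 10); (56%N, 1); (57%N, 21); (58%N, 17); (59%N, -17); (60%N, -3);
  (61%N, -3); (62%N, 17); (64%N, -2); (65%N, 6); (66%N, -15); (68%N, 8);
  (69%N, 3); (70%N, -17); (71%N, -5); (72%N, 7); (73%N, -16); (74%N, 9);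
  (78%N, -8); (80%N, -6); (81%N, 1); (82%N, 7); (83%N, -12); (84%N, 5);
  (85%N, 7); (86%N, 9); (87%N, 8); (88%N, 3); (89%N, -1); (93%N, 5);
  (94%N, 7); (95%N, 1); (96%N, -3); (97%N, -1); (98%N, -1); (99%N, -4);
  (102%N, -7); (103%N, -9); (105%N, -3); (107%N, -9); (110%N, -9);
  (111%N, 5); (112%N, 1); (114%N, -10); (116%N, -3); (118%N, 7); (119%N, 4);
  (122%N, 4); (123%N, 8); (125%N, 1); (129%N, 1); (130%N, 3)].

(** The pairs (s_i, w_i): a step of height w_i at v = 240 s_i. *)
Definition tail_weights : seq (nat * Z) := [::
  (2%N, 55); (3%N, 787); (6%N, 505); (8%N, 728); (10%N, 772); (12%N, 1019);
  (48%N, 1084); (480%N, 51636)].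

(** The value of the difference at v = 15. *)
Definition peak : Z := 1000.

Lemma sieve_blocks_checked :
  check_blocks peak tail_weights 480 0 (tabulate (16 * 480) (counters sieve_weights 0) 0)
      (tabulate (15 * 480) (counters sieve_weights 0) 0) = true.
Proof. by vm_compute. Qed.

(** Thirty times u - u / 2 - u / 3 - u / 5 + u / 30. *)
Definition chebyshev_weights : seq (nat * Z) :=
  [:: (1%N, 30); (2%N, -15); (3%N, -10); (5%N, -6); (30%N, 1)].

Lemma sieve_periods : all (fun x => 0 < x.1)%N sieve_weights.
Proof. by vm_compute. Qed.

Lemma sieve_balanced : zsum snd sieve_weights = Z0.
Proof. by vm_compute. Qed.

Lemma tail_starts : all (fun x => 0 < x.1 <= 480)%N tail_weights.
Proof. by vm_compute. Qed.

Lemma tail_weights_ge0 : all (fun x => 0 <= x.2)%R tail_weights.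
Proof. by vm_compute. Qed.

Lemma tail_starts_dvd : all (fun x => x.1 %| 480)%N tail_weights.
Proof. by vm_compute. Qed.

Lemma tail_total_ge :
  (zsum (fun x => Z.mul (Z.abs x.2) (Z.of_nat x.1.-1)) sieve_weights
    <= zsum snd tail_weights)%R.
Proof. by vm_compute. Qed.

Lemma sieve_rate_large :
  (rate_upper chebyshev_weights *
     zsum (fun x => Z.mul x.2 (Z.of_nat (480 %/ x.1))) tail_weights
   < rate_lower sieve_weights * Z.of_nat (25 * 480))%R.
Proof. by vm_compute. Qed.

Lemma rates_ge0 :
  ((0 <= rate_lower sieve_weights) && (0 <= rate_lower chebyshev_weights))%R.
Proof. by vm_compute. Qed.

End Certificate.

(** * Primes between 15x and 16x *)

Section Certified.
Variable R : realType.

Lemma sieve_difference_le v :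
  floor_comb (real_comb R sieve_weights) (v %/ 15)%N -
  floor_comb (real_comb R sieve_weights) (v %/ 16)%N <=
  real_of_Z R peak * (v == 15)%:R +
  \sum_(x <- real_comb R tail_weights) x.2 * (0 < v %/ (240 * x.1))%N%:R.
Proof.
rewrite !floor_comb_real -rmorphB big_map.
have -> : real_of_Z R peak * (v == 15)%:R +
    \sum_(x <- tail_weights) real_of_Z R x.2 * (0 < v %/ (240 * x.1))%N%:R =
    real_of_Z R (peak * (v == 15)%N%:R +
          \sum_(x <- tail_weights) x.2 * (0 < v %/ (240 * x.1))%N%:R).
  rewrite rmorphD [in RHS]rmorphM rmorph_nat rmorph_sum; congr (_ + _).
  by apply: eq_bigr => x _; rewrite [RHS]rmorphM rmorph_nat.
rewrite real_of_Z_le; apply: (@certified_difference_le _ _ _ 480 _ _ _ _ _ sieve_blocks_checked).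
- exact: sieve_periods.
- by rewrite -(zsumE snd) sieve_balanced.
- exact: tail_starts.
- rewrite -(zsumE snd); apply: le_trans tail_total_ge.
  rewrite zsumE le_eqVlt; apply/orP; left; apply/eqP; apply: eq_bigr => x _.
  by rewrite -Z_of_natE.
- by [].
Qed.

Lemma ln6_ge1 : 1 <= ln (6%:R : R).
Proof.
(* ln 2 >= 1/2 and ln 3 >= 2/3 *)
have h2 : ln 2^-1 <= 2^-1 - 1 :> R by apply: ln_le_sub1; rewrite invr_gt0.
have h3 : ln 3^-1 <= 3^-1 - 1 :> R by apply: ln_le_sub1; rewrite invr_gt0.
rewrite !lnV ?posrE // in h2 h3.
have -> : 6%:R = 2 * 3 :> R by rewrite -natrM.
by rewrite lnM ?posrE //; lra.
Qed.

Definition chebyshev_rate : R := log_rate (real_comb R chebyshev_weights) / 30.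

Lemma chebyshev_rate_ge0 : 0 <= chebyshev_rate.
Proof.
have /andP[_ r0] := rates_ge0.
exact: divr_ge0 (log_rate_ge0 R chebyshev_weights isT r0) (ler0n _ _).
Qed.

Definition chebyshev_constant : R := chebyshev_rate * (6 / 5).

Lemma chebyshev_constant_ge0 : 0 <= chebyshev_constant.
Proof.
by apply: mulr_ge0 chebyshev_rate_ge0 _; rewrite divr_ge0 ?ler0n.
Qed.

Lemma sieve_rate_ge0 : 0 <= log_rate (real_comb R sieve_weights).
Proof.
by have /andP[r0 _] := rates_ge0; exact: log_rate_ge0 sieve_periods r0.
Qed.

(** The function u - u / 2 - u / 3 - u / 5 + u / 30 is periodic with values 0 and
    1, and is 1 from 1 to 5. *)
Lemma chebyshev_minorant v :
  (0 < v)%:R - (0 < v %/ 6)%:R <=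
  30^-1 * floor_comb (real_comb R chebyshev_weights) v.
Proof.
have h : ((0 < v) + v %/ 2 + v %/ 3 + v %/ 5 <= v + v %/ 30 + (0 < v %/ 6))%N by lia.
have e30 : real_of_Z R (Zpos 30) = 30 := real_of_Z_of_nat R 30.
have e15 : real_of_Z R (Zneg 15) = - 15 by rewrite -(real_of_Z_of_nat R 15) -real_of_ZN.
have e10 : real_of_Z R (Zneg 10) = - 10 by rewrite -(real_of_Z_of_nat R 10) -real_of_ZN.
have e6 : real_of_Z R (Zneg 6) = - 6 by rewrite -(real_of_Z_of_nat R 6) -real_of_ZN.
have e1 : real_of_Z R (Zpos 1) = 1 := real_of_Z_of_nat R 1.
rewrite /floor_comb !big_cons big_nil e30 e15 e10 e6 e1 divn1 !natrM.
by move: h; rewrite -(ler_nat R) !natrD; cbn [fst snd]; lra.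
Qed.

Lemma psi_le_linear : exists2 E : R, 0 <= E & forall N n, (0 < n <= N)%N ->
  psi N n <= chebyshev_constant * n%:R + E * (ln n%:R + 1) ^+ 2.
Proof.
set b := real_comb R chebyshev_weights.
exists (30^-1 * \sum_(x <- b) `|x.2| * x.1%:R).
  by rewrite mulr_ge0 ?invr_ge0 // sumr_ge0 // => x _; rewrite mulr_ge0.
have -> : chebyshev_constant = chebyshev_rate * (6%:R / (6%:R - 1)).
  by congr (_ * (_ / _)); lra.
move=> N; apply: psi_le_of_minorant chebyshev_minorant _ => //.
- exact: ln6_ge1.
- exact: chebyshev_rate_ge0.
- by rewrite mulr_ge0 ?invr_ge0 // sumr_ge0 // => x _; rewrite mulr_ge0.
move=> n nN; rewrite mangoldt_sumZ.
have := @mangoldt_sum_balanced R N b n isT _ nN.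
rewrite real_comb_balanced // => /(_ erefl); rewrite ler_norml /chebyshev_rate -/b.
lra.
Qed.

End Certified.

Theorem theorem11 (R : realType) (N : nat) (N_gt0 : (0 < N)%N) :
  exists L : nat, (0 < L)%N /\
    forall x : R, L%:R <= x ->
      `I_N #<= [set p : nat | prime p /\ 15 * x <= p%:R <= 16 * x].
Proof.
have sieve0 := sieve_rate_ge0 R.
have [E E0 psiE] := psi_le_linear R; have c0 := chebyshev_constant_ge0 R.
set c := chebyshev_constant R in psiE c0.
have gap : c * \sum_(x <- real_comb R tail_weights) x.2 / x.1%:R <
    log_rate (real_comb R sieve_weights).
  have := log_rate_gap R _ chebyshev_weights _ 480 sieve_periods isT isT
    tail_starts_dvd tail_weights_ge0 sieve_rate_large.
  rewrite /c /chebyshev_constant /chebyshev_rate.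
  set a := log_rate _; set S := \sum_(x <- _) _.
  by set r := log_rate _; lra.
have peak0 : 0 <= real_of_Z R peak by rewrite -(rmorph0 (real_of_Z R)) real_of_Z_le.
have pos : all (fun x => 0 < x.1)%N (real_comb R sieve_weights).
  by rewrite all_map; exact: sieve_periods.
have tails : all (fun x => (0 < x.1)%N && (0 <= x.2)) (real_comb R tail_weights).
  rewrite all_map; apply/allP => x xw /=.
  have /andP[-> _] /= := allP tail_starts _ xw.
  by rewrite -(rmorph0 (real_of_Z R)) real_of_Z_le (allP tail_weights_ge0).
have [K [K0 KP]] := sieve_lower_bound R _ _ _ _ _ pos
  (real_comb_balanced R _ sieve_balanced) tails peak0 E0 c0
  (sieve_difference_le R) psiE sieve0.
apply: primes_between_of_quotient; apply: eventually_many _ peak0 K0 KP _.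
by rewrite divr_gt0 // subr_gt0.
Qed.
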